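(* The equivalence of first-visit Monte Carlo (MC) with the minimum variance unbiased estimator (MVU) and the maximum likelihood (ML, equivalently LSTD) value estimator under the Full Information Criterion fails in the discounted case: for every $\gamma\in(0,1)$ there exist a Markov Reward Process with discount $\gamma$, a state $s$ to which the Full Information Criterion applies, and a number $n$ of observed i.i.d. paths such that with positive probability the first-visit MC estimator of $V_s$ differs from the MVU and from the ML value estimator of $V_s$.
   Context: A Markov Reward Process (MRP) has a finite state space $\mathbb S$, starting probabilities $p_i$, transition probabilities $p_{ij}$, rewards $R_{ij}$ received on a transition $i\to j$, and a discount $\gamma\in(0,1]$. Terminal states have no outgoing transitions and value $0$. The value is $V_i=\sum_j p_{ij}(\mathbb E[R_{ij}]+\gamma V_j)$. The possible starts and transitions are known; the probabilities are unknown parameters. The sample consists of $n$ i.i.d. paths, each run until a terminal state, with their rewards; $K_i$ is the total number of visits to $i$ and $\mu_{ij}$ the number of observed direct transitions $i\to j$. First-visit Monte Carlo estimator $\bar V_s$: the average, over all observed paths that visit $s$, of the discounted sum of rewards following the first visit to $s$ in that path. MVU: $\mathbb E[\bar V_s\mid\mathcal S]$, where $\mathcal S$ is the minimal complete sufficient statistic of the MRP (for deterministic rewards: numbers of starts in each state and the counts $\mu_{ij}$). ML value estimator: $\bar p_{ij}=\mu_{ij}/K_i$ ($\bar p_{ij}=0$ if $K_i=0$), $\bar{\mathbf P}=(\bar p_{ij})$, $\bar r_i=\sum_j\bar p_{ij}\bar R_{ij}$ with $\bar R_{ij}$ the ML estimate of $\mathbb E[R_{ij}]$ (equal to $R_{ij}$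 for deterministic rewards); the estimator is the vector $(\mathbf I-\gamma\bar{\mathbf P})^{-1}\bar{\mathbf r}$. Full Information Criterion for a state $s$: for every successor state $s'\neq s$ of $s$ (a state reachable from $s$ with positive probability) and every path $\pi$ that the MRP can generate, $\pi(i)=s'$ implies that there is $j<i$ with $\pi(j)=s$, where $\pi(i)$ is the $i$-th state of the path. *)

(* Defs.v *)
From mathcomp Require Import all_boot all_order all_algebra.
From mathcomp Require Import all_classical all_reals all_analysis.

Set Implicit Arguments.
Unset Strict Implicit.
Unset Printing Implicit Defensive.

Import Order.TTheory GRing.Theory Num.Theory.

Local Open Scope classical_set_scope.
Local Open Scope ring_scope.

(* The unknown parameters: starting and transition probabilities on the finite
   state space {0, ..., N-1}. A state is terminal when it has no outgoing
   transition. [chain_proper] says that a path reaches a terminal state almost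
   surely. *)
Record chain (R : realType) (N : nat) := Chain {
  start : 'I_N -> R;
  trans : 'I_N -> 'I_N -> R;
  terminal i := [forall j, trans i j == 0];
  step : rel 'I_N := fun i j => 0 < trans i j;
  start_ge0 : forall i, 0 <= start i;
  start_sum1 : \sum_i start i = 1;
  trans_ge0 : forall i j, 0 <= trans i j;
  trans_sum : forall i, ~~ terminal i -> \sum_j trans i j = 1;
  chain_proper : forall i j, 0 < start i -> connect step i j ->
    exists2 k, connect step j k & terminal k }.

(* Rewards are deterministic: [reward i j] is received on a transition from i
   to j. *)
Record mrp (R : realType) (N : nat) := Mrp {
  mrp_chain :> chain R N;
  reward : 'I_N -> 'I_N -> R;
  discount : R;
  discount_gt0 : 0 < discount;
  discount_le1 : discount <= 1 }.

(* The possible starts and transitions are known, so the statistical model is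
   the family of all [Q] with [same_support P Q]. *)
Definition same_support (R : realType) (N : nat) (P Q : chain R N) :=
  (forall i, (0 < start Q i) = (0 < start P i)) /\
  (forall i j, (0 < trans Q i j) = (0 < trans P i j)).

(* The sequence of visited states, from the start up to the terminal state. *)
Definition path_of (N : nat) := seq 'I_N.

Definition transitions (N : nat) (w : path_of N) : seq ('I_N * 'I_N) :=
  zip w (behead w).

Definition path_prob (R : realType) (N : nat) (P : chain R N)
    (w : path_of N) : R :=
  if w is i :: v then
    start P i * (\prod_(e <- transitions w) trans P e.1 e.2)
      * (terminal P (last i v))%:R
  else 0.

(* Full Information Criterion for the state s. *)
Definition full_information (R : realType) (N : nat) (P : chain R N)
    (s : 'I_N) :=
  forall s', s' != s -> connect (step P) s s' ->
  forall w : path_of N, 0 < path_prob P w ->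
  forall i, onth w i = Some s' -> exists2 j, (j < i)%N & onth w j = Some s.

(* n i.i.d. paths. The sample space is discrete: laws are given by their mass
   function, and probabilities and expectations are (unordered) sums. *)
Definition sample (N n : nat) := n.-tuple (path_of N).

Section Sampling.
Context (R : realType) (N n : nat).
Implicit Types (P Q : chain R N) (x y : sample N n).

Definition sample_prob P x : R := \prod_(w <- x) path_prob P w.

Definition Pr P (A : set (sample N n)) : \bar R :=
  \esum_(x in A) (sample_prob P x)%:E.

(* E[X ; A], the expectation of X restricted to the event A. *)
Definition integrable_rv P (X : sample N n -> R) : Prop :=
  summable [set: sample N n] (fun x => (sample_prob P x * X x)%:E).

Definition expect_on P (A : set (sample N n)) (X : sample N n -> R) : R :=
  let f x := (sample_prob P x * X x)%:E in
  fine (\esum_(x in A) f^\+ x)%E - fine (\esum_(x in A) f^\- x)%E.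

Definition expect P (X : sample N n -> R) : R := expect_on P setT X.

(* E[X | S], which at x is E[X ; S = S x] / Pr(S = S x). *)
Definition cond_expect (T : Type) P (X : sample N n -> R)
    (S : sample N n -> T) (x : sample N n) : R :=
  expect_on P [set y | S y = S x] X / fine (Pr P [set y | S y = S x]).

(* The conditional law of the sample given S does not depend on the
   parameters. *)
Definition sufficient (T : Type) P (S : sample N n -> T) :=
  forall Q Q', same_support P Q -> same_support P Q' ->
  forall t, (0 < Pr Q [set x | S x = t])%E -> (0 < Pr Q' [set x | S x = t])%E ->
  forall x, S x = t ->
    sample_prob Q x / fine (Pr Q [set y | S y = t]) =
    sample_prob Q' x / fine (Pr Q' [set y | S y = t]).

Definition complete (T : Type) P (S : sample N n -> T) :=
  forall g : T -> R,
    (forall Q, same_support P Q ->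
       integrable_rv Q (g \o S) /\ expect Q (g \o S) = 0) ->
  forall Q, same_support P Q -> Pr Q [set x | g (S x) <> 0] = 0%E.

(* Almost surely a function of any sufficient statistic. *)
Definition minimal (T : Type) P (S : sample N n -> T) :=
  forall (U : Type) (Y : sample N n -> U), sufficient P Y ->
  exists f : U -> T, forall Q, same_support P Q ->
    Pr Q [set x | S x <> f (Y x)] = 0%E.

Definition minimal_complete_sufficient (T : Type) P (S : sample N n -> T) :=
  [/\ sufficient P S, complete P S & minimal P S].

End Sampling.

Section Estimators.
Context (R : realType) (N n : nat).
Implicit Types (M : mrp R N) (s i j : 'I_N) (x : sample N n).

Definition num_starts x i : nat := count (fun w => ohead w == Some i) x.

Definition num_visits x i : nat := (\sum_(w <- x) count_mem i w)%N.

Definition num_trans x i j : nat :=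
  (\sum_(w <- x) count_mem (i, j) (transitions w))%N.

Definition count_stat x : {ffun 'I_N -> nat} * {ffun 'I_N * 'I_N -> nat} :=
  ([ffun i => num_starts x i], [ffun e => num_trans x e.1 e.2]).

(* Discounted sum of the rewards following the first visit to s in w. *)
Definition first_visit_return M s (w : path_of N) : R :=
  let v := drop (index s w) w in
  \sum_(k < (size v).-1)
    discount M ^+ k * reward M (nth s v k) (nth s v k.+1).

(* The value is 0 when no observed path visits s; in that case MVU and ML
   below are 0 as well. *)
Definition MC M s x : R :=
  (\sum_(w <- x | s \in w) first_visit_return M s w)
    / (count (fun w => s \in w) x)%:R.

Definition MVU M s x : R := cond_expect M (MC M s) count_stat x.

(* Division by 0 gives 0, as required when a state is not visited. *)
Definition trans_hat x : 'M[R]_N :=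
  \matrix_(i, j) ((num_trans x i j)%:R / (num_visits x i)%:R).

Definition reward_hat M x : 'cV[R]_N :=
  \col_i \sum_j trans_hat x i j * reward M i j.

Definition ML M s x : R :=
  (invmx (1%:M - discount M *: trans_hat x) *m reward_hat M x) s 0.

End Estimators.

(* Main.v *)
(** Take a single non-terminal state 0 with a loop, which is left with reward 1
    to the terminal state 1, and observe two paths. A path with [k] loops has
    return [gamma ^ k], the statistic amounts to the total number of loops, and
    its distribution is a power series family in the loop probability, whence
    completeness. When both paths loop once, the estimators are
    MC = [gamma], MVU = [(1 + gamma + gamma ^ 2) / 3] (the average over the loop
    numbers (0, 2), (1, 1), (2, 0)) and ML = [1 / (2 - gamma)]; equality of MC
    with either of the others amounts to [(1 - gamma) ^ 2 = 0]. *)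

Require Import Defs.
From mathcomp Require Import all_boot all_order all_algebra.
From mathcomp Require Import all_classical all_reals all_analysis.
From mathcomp Require Import ring lra zify.

Import Order.TTheory GRing.Theory Num.Theory.
Local Open Scope classical_set_scope.
Local Open Scope ring_scope.

(** * Unordered sums of extended reals *)

Lemma esum_scale (R : realType) (T : choiceType) (I : set T)
    (a : T -> \bar R) (c : R) : 0 < c -> (forall i, (0 <= a i)%E) ->
  (\esum_(i in I) (c%:E * a i) = c%:E * \esum_(i in I) a i)%E.
Proof.
have le_scale (d : R) (b : T -> \bar R) : 0 < d -> (forall i, (0 <= b i)%E) ->
    (\esum_(i in I) (d%:E * b i) <= d%:E * \esum_(i in I) b i)%E.
  move=> d0 b0; apply: ge_ereal_sup => _ [X [finX XI]] <-.
  rewrite -ge0_mule_fsumr// lee_pmul2l ?lte_fin//.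
  by apply: esum_ge; exists X.
move=> c0 a0; apply/eqP; rewrite eq_le le_scale//=.
(* The reverse inequality is [le_scale] for the factor [c^-1] and the family [c * a]. *)
rewrite -(@lee_pmul2l _ c^-1%:E) ?lte_fin ?invr_gt0// muleA -EFinM.
rewrite mulVf ?gt_eqF// mul1e.
have <- : (\esum_(i in I) (c^-1%:E * (c%:E * a i)) = \esum_(i in I) a i)%E.
  by apply: eq_esum => i _; rewrite muleA -EFinM mulVf ?gt_eqF// mul1e.
apply: le_scale => [|i]; first by rewrite invr_gt0.
by rewrite mule_ge0 ?lee_fin ?(ltW c0).
Qed.

(** Terms off the range of [e] vanish. This serves to turn sums over all samples into double series
    over pairs of loop numbers. *)
Lemma esum_inj_support (R : realType) (T T' : choiceType) (e : T -> T')
    (A : set T') (f : T' -> \bar R) :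
  injective e -> (forall y, ~ range e y -> f y = 0%E) ->
  (\esum_(y in A) f y = \esum_(x in e @^-1` A) f (e x))%E.
Proof.
move=> e_inj f0.
transitivity (\esum_(y in A `&` range e) f y)%E.
  rewrite esum_mkcondr; apply: eq_esum => y _.
  by case: ifPn => // /negP; rewrite in_setE => /f0.
rewrite -(@esum_image _ _ _ (e @^-1` A) e f); last first.
  by move=> x y _ _; exact: e_inj.
congr (esum _ _); apply/seteqP; split=> [y [Ay [x _ xy]]|_ [x Ax <-]].
  by exists x => //=; rewrite xy.
by split=> //; exists x.
Qed.

(** * The one-loop chain and its statistical model *)

Lemma ord2E (i : 'I_2) : i = 0 \/ i = 1.
Proof. by case: i => [[|[|//]]] lt_i; [left|right]; apply: val_inj. Qed.

Definition loop_trans (R : realType) (p : R) (i j : 'I_2) : R :=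
  if i == 0 then if j == 0 then p else 1 - p else 0.

Definition loop_chain (R : realType) (p : R) (p01 : 0 < p < 1) : chain R 2.
Proof.
refine (@Chain R 2 (fun i => (i == 0)%:R) (loop_trans R p) _ _ _ _ _).
- by move=> i; rewrite ler0n.
- by rewrite !big_ord_recl big_ord0 /= !addr0.
- by move=> i j; rewrite /loop_trans; case: ifP => // _; case: ifP => _; lra.
- move=> i; case: (ord2E i) => ->.
    by move=> _; rewrite !big_ord_recl big_ord0 /loop_trans /=; lra.
  by move/forallPn => [j]; rewrite /loop_trans /= eqxx.
move=> i j _ _; exists 1; last first.
  by apply/forallP => k; rewrite /loop_trans /=.
case: (ord2E j) => ->; last exact: connect0.
by apply: connect1; rewrite /loop_trans /=; lra.
Defined.

(** A chain of the model is known only through its support, so later computations are stated for any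
    chain with these entries rather than for [loop_chain] itself. *)
Record is_loop (R : realType) (Q : chain R 2) (q : R) : Prop := IsLoop {
  loop_q : 0 < q < 1;
  loop_start0 : start Q 0 = 1;
  loop_start1 : start Q 1 = 0;
  loop_trans00 : trans Q 0 0 = q;
  loop_trans01 : trans Q 0 1 = 1 - q;
  loop_trans1 : forall j, trans Q 1 j = 0 }.

Lemma is_loop_chain (R : realType) (p : R) (p01 : 0 < p < 1) :
  is_loop R (loop_chain R p p01) p.
Proof. by split. Qed.

Lemma sum_ord2 (V : nmodType) (f : 'I_2 -> V) : \sum_i f i = f 0 + f 1.
Proof.
rewrite !big_ord_recl big_ord0 addr0; congr (_ + f _); exact: val_inj.
Qed.

Lemma loop_terminal1 (R : realType) (Q : chain R 2) (q : R) :
  is_loop R Q q -> terminal Q 1.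
Proof. by move=> lQ; apply/forallP => j; rewrite (loop_trans1 _ _ _ lQ). Qed.

Lemma loop_terminal0 (R : realType) (Q : chain R 2) (q : R) :
  is_loop R Q q -> terminal Q 0 = false.
Proof.
move=> lQ; apply/negP => /forallP/(_ 0); rewrite (loop_trans00 _ _ _ lQ).
by have := loop_q _ _ _ lQ; case: eqP => // ->; rewrite ltxx.
Qed.

(** Impossible starts and transitions have probability 0, being nonnegative and not positive; the
    two normalisations then leave a single free parameter. *)
Lemma same_support_loop (R : realType) (p : R) (p01 : 0 < p < 1)
    (Q : chain R 2) : same_support (loop_chain R p p01) Q ->
  is_loop R Q (trans Q 0 0).
Proof.
move=> [Hs Ht].
have s1 : start Q 1 = 0.
  by apply/eqP; rewrite eq_le start_ge0 leNgt Hs/= ltxx.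
have t1 j : trans Q 1 j = 0.
  by apply/eqP; rewrite eq_le trans_ge0 leNgt Ht/= /loop_trans/= ltxx.
have t00 : 0 < trans Q 0 0 by rewrite Ht /= /loop_trans /=; lra.
have t01 : 0 < trans Q 0 1 by rewrite Ht /= /loop_trans /=; lra.
have : \sum_j trans Q 0 j = 1.
  apply: trans_sum; apply/negP => /forallP/(_ 0); by rewrite gt_eqF.
have := start_sum1 Q; rewrite !sum_ord2 s1 => st tr.
by split=> //; lra.
Qed.

Lemma loop_same_support (R : realType) (p q : R) (p01 : 0 < p < 1)
    (q01 : 0 < q < 1) : same_support (loop_chain R p p01) (loop_chain R q q01).
Proof.
by split=> // i j; rewrite /= /loop_trans; do 2?case: ifP => _ //; lra.
Qed.

(** * Possible paths, possible samples and their counts *)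

Definition loop_path (k : nat) : path_of 2 := 0 :: rcons (nseq k 0) 1.

Lemma loop_path_prob (R : realType) (Q : chain R 2) (q : R) k :
  is_loop R Q q -> path_prob Q (loop_path k) = q ^+ k * (1 - q).
Proof.
move=> lQ; rewrite /path_prob /loop_path last_rcons (loop_terminal1 _ _ _ lQ).
rewrite (loop_start0 _ _ _ lQ) mulr1 mul1r /transitions /=.
elim: k => [|k IH].
  by rewrite /= big_cons big_nil (loop_trans01 _ _ _ lQ) expr0 mulrC.
by rewrite /= big_cons IH /= (loop_trans00 _ _ _ lQ) exprS mulrA.
Qed.

(** Some factor vanishes: a possible path starts in 0, cannot leave 1, and must stop in a terminal
    state. The induction is on the tail after the start. *)
Lemma path_prob_eq0 (R : realType) (Q : chain R 2) (q : R) w :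
  is_loop R Q q -> ~ range loop_path w -> path_prob Q w = 0.
Proof.
move=> lQ nw; case: w nw => // i v; rewrite /path_prob.
case: (ord2E i) => -> nw; last by rewrite (loop_start1 _ _ _ lQ) !mul0r.
rewrite -mulrA; apply/eqP; rewrite mulf_eq0; apply/orP; right.
have {nw} : forall k, v <> rcons (nseq k 0) 1.
  by move=> k vk; apply: nw; exists k => //; rewrite vk.
rewrite /transitions /=.
elim: v => [_|j v IH nv]; first by rewrite /= (loop_terminal0 _ _ _ lQ) mulr0.
rewrite /= big_cons /=; case: (ord2E j) nv => -> nv.
  rewrite -mulrA mulf_eq0 IH ?orbT// => k vk.
  by apply: (nv k.+1); rewrite vk.
(* Stopping in 1 is the excluded case of no further loop; going on uses a transition out of 1, of
   probability 0. *)
case: v {IH} nv => [|j' v] nv; first by have := nv 0%N.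
by rewrite /= big_cons /= (loop_trans1 _ _ _ lQ) mul0r mulr0 mul0r.
Qed.

Definition loop_sample (k : nat * nat) : sample 2 2 :=
  [tuple loop_path k.1; loop_path k.2].

Lemma loop_sample_inj : injective loop_sample.
Proof.
move=> [k1 k2] [l1 l2] /(congr1 val) [].
by move=> /(congr1 size) + /(congr1 size); rewrite !size_rcons !size_nseq
  => -[->] [->].
Qed.

Lemma sample_prob_loop (R : realType) (Q : chain R 2) (q : R) k :
  is_loop R Q q ->
  sample_prob Q (loop_sample k) = q ^+ (k.1 + k.2) * (1 - q) ^+ 2.
Proof.
move=> lQ; rewrite /sample_prob /= !big_cons big_nil !(loop_path_prob _ _ _ _ lQ).
by rewrite exprD; ring.
Qed.

Lemma sample_prob_eq0 (R : realType) (Q : chain R 2) (q : R) x :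
  is_loop R Q q -> ~ range loop_sample x -> sample_prob Q x = 0.
Proof.
move=> lQ; case/tupleP: x => w1 x; case/tupleP: x => w2 x.
rewrite (tuple0 x) => nx; rewrite /sample_prob /= !big_cons big_nil.
have [[k _ Ek]|/(path_prob_eq0 _ _ _ _ lQ) ->] := pselect (range loop_path w1);
  last by rewrite mul0r.
have [[l _ El]|/(path_prob_eq0 _ _ _ _ lQ) ->] := pselect (range loop_path w2);
  last by rewrite mul0r mulr0.
by exfalso; apply: nx; exists (k, l) => //; apply: val_inj; rewrite /= Ek El.
Qed.

(** The counts of two possible paths with [m] loops in total: both start in 0 and each moves to 1
    exactly once. *)
Definition loop_stat (m : nat) :
    {ffun 'I_2 -> nat} * {ffun 'I_2 * 'I_2 -> nat} :=
  ([ffun i => if i == 0 then 2%N else 0%N],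
   [ffun e => if e == (0, 0) then m else if e == (0, 1) then 2%N else 0%N]).

Lemma loop_stat_inj : injective loop_stat.
Proof.
by move=> m m' /(congr1 snd)/ffunP/(_ (0, 0)); rewrite !ffunE eqxx.
Qed.

Lemma count_mem_transitions_loop k e :
  count_mem e (transitions (loop_path k)) =
  ((if e == (0%R, 0%R) then k else 0) + (e == (0%R, 1%R)))%N.
Proof.
rewrite /transitions /loop_path /=.
elim: k => [|k IH] /=; first by rewrite addn0 [in LHS]eq_sym; case: ifP.
by rewrite IH [in LHS]eq_sym; case: ifP.
Qed.

Lemma num_trans_loop k i j : num_trans (loop_sample k) i j =
  (if (i, j) == (0%R, 0%R) then k.1 + k.2
   else if (i, j) == (0%R, 1%R) then 2 else 0)%N.
Proof.
rewrite /num_trans /= !big_cons big_nil !count_mem_transitions_loop.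
by case: eqP => [[-> ->]|_] /=; rewrite ?addn0//; case: eqP.
Qed.

Lemma count_stat_loop k : count_stat (loop_sample k) = loop_stat (k.1 + k.2).
Proof.
rewrite /count_stat /loop_stat; congr (_, _); apply/ffunP => i; rewrite !ffunE.
  by case: (ord2E i) => ->.
by rewrite num_trans_loop -surjective_pairing.
Qed.

Lemma num_visits_loop k : num_visits (loop_sample k) 0 = (k.1 + k.2 + 2)%N.
Proof.
rewrite /num_visits /= !big_cons !big_nil /loop_path /= -!cats1 !count_cat.
by rewrite !count_nseq /=; lia.
Qed.

(** * Probabilities as double series *)

Lemma le_esum_term (R : realType) (T : choiceType) (I : set T)
    (f : T -> \bar R) (t : T) : I t -> (f t <= \esum_(x in I) f x)%E.
Proof.
move=> It; apply: esum_ge; exists [set t]; last by rewrite fsbig_set1.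
by split; [exact: finite_set1|move=> _ ->].
Qed.

Definition loop_mass (R : realType) (q : R) (k : nat * nat) : R :=
  q ^+ (k.1 + k.2) * (1 - q) ^+ 2.

Lemma loop_mass_gt0 (R : realType) (q : R) k : 0 < q < 1 -> 0 < loop_mass R q k.
Proof. by move=> /andP[q0 q1]; rewrite mulr_gt0 ?exprn_gt0// subr_gt0. Qed.

Lemma Pr_loop (R : realType) (Q : chain R 2) (q : R) (A : set (sample 2 2)) :
  is_loop R Q q ->
  Pr Q A = \esum_(k in loop_sample @^-1` A) (loop_mass R q k)%:E.
Proof.
move=> lQ; rewrite /Pr (esum_inj_support _ _ _ loop_sample); first last.
- by move=> x /(sample_prob_eq0 _ _ _ _ lQ) ->.
- exact: loop_sample_inj.
by apply: eq_esum => k _; rewrite (sample_prob_loop _ _ _ _ lQ).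
Qed.

Lemma esum_geometric (R : realType) (q : R) : 0 < q < 1 ->
  (\esum_(i in [set: nat]) (q ^+ i * (1 - q))%:E = 1)%E.
Proof.
move=> /andP[q0 q1].
rewrite -nneseries_esumT; last first.
  by move=> i; rewrite lee_fin mulr_ge0 ?exprn_ge0 ?subr_ge0// ltW.
apply/cvg_lim => //.
have -> : (fun n => \sum_(0 <= i < n) (q ^+ i * (1 - q))%:E)%E
    = EFin \o series (geometric (1 - q) q).
  apply/funext => n /=; rewrite sumEFin; congr EFin.
  by apply: eq_bigr => i _; rewrite mulrC.
apply: cvg_EFin; first by near=> n.
have := @cvg_geometric_series R (1 - q) q.
rewrite divff ?subr_eq0 ?gt_eqF// => h.
by apply: h; rewrite ger0_norm ?ltW.
Unshelve. all: by end_near.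
Qed.

(** The two loop numbers are independent geometric variables, so the mass factors and each iterated
    sum is a geometric series with sum 1. *)
Lemma esum_loop_mass (R : realType) (q : R) : 0 < q < 1 ->
  (\esum_(k in [set: nat * nat]) (loop_mass R q k)%:E = 1)%E.
Proof.
move=> q01; have /andP[q0 q1] := q01.
have c0 i : 0 < q ^+ i * (1 - q) by rewrite mulr_gt0 ?exprn_gt0 ?subr_gt0.
pose a i j : \bar R := ((q ^+ i * (1 - q))%:E * (q ^+ j * (1 - q))%:E)%E.
transitivity (\esum_(k in [set: nat] `*`` (fun _ => [set: nat])) a k.1 k.2)%E.
  have -> : [set: nat] `*`` (fun _ => [set: nat]) = [set: nat * nat].
    by apply/seteqP; split.
  apply: eq_esum => k _; rewrite /a /loop_mass -EFinM exprD; congr EFin; ring.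
rewrite -esum_esum; last first.
  by move=> i j _ _; rewrite mule_ge0// lee_fin ltW.
rewrite -[RHS](esum_geometric _ _ q01); apply: eq_esum => i _.
rewrite esum_scale ?esum_geometric ?mule1// => j.
by rewrite lee_fin ltW.
Qed.

Lemma Pr_loop_le1 (R : realType) (Q : chain R 2) (q : R) (A : set (sample 2 2)) :
  is_loop R Q q ->
  (Pr Q A <= 1)%E.
Proof.
move=> lQ; rewrite (Pr_loop _ _ _ _ lQ) -(esum_loop_mass _ _ (loop_q _ _ _ lQ)).
rewrite esum_mkcond; apply: le_esum => k _; case: ifP => // _.
by rewrite lee_fin ltW// loop_mass_gt0//; apply: loop_q lQ.
Qed.

Lemma Pr_loop_gt0 (R : realType) (Q : chain R 2) (q : R)
    (A : set (sample 2 2)) k :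
  is_loop R Q q ->
  A (loop_sample k) -> (0 < Pr Q A)%E.
Proof.
move=> lQ Ak; rewrite (Pr_loop _ _ _ _ lQ).
apply: (lt_le_trans _ (le_esum_term _ _ _ _ k _)) => //.
by rewrite lte_fin loop_mass_gt0//; apply: loop_q lQ.
Qed.

Lemma fine_Pr_loop_gt0 (R : realType) (Q : chain R 2) (q : R)
    (A : set (sample 2 2)) k :
  is_loop R Q q -> A (loop_sample k) -> 0 < fine (Pr Q A).
Proof.
move=> lQ Ak; rewrite fine_gt0// (Pr_loop_gt0 _ _ _ _ _ lQ Ak)/=.
exact: le_lt_trans (Pr_loop_le1 _ _ _ _ lQ) (ltry _).
Qed.

(** At both infinities [fine] is 0 and the positive factor [c] changes nothing, so the equation
    holds there too. *)
Lemma fine_scale (R : realType) (c : R) (x : \bar R) :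
  0 < c -> fine (c%:E * x)%E = c * fine x.
Proof.
case: x => [x| |] c0; first by rewrite -EFinM.
- by rewrite mulry gtr0_sg// mul1e mulr0.
- by rewrite mulrNy gtr0_sg// mul1e mulr0.
Qed.

(** * Sufficiency, minimality and completeness of the counts *)

Lemma count_stat_loop_sufficient (R : realType) (p : R) (p01 : 0 < p < 1) :
  sufficient (loop_chain R p p01) (@count_stat 2 2).
Proof.
move=> Q Q' /same_support_loop lQ /same_support_loop lQ' t _ _ x <-.
have [[k _ <-]|nx] := pselect (range loop_sample x); last first.
  by rewrite (sample_prob_eq0 _ _ _ _ lQ)// (sample_prob_eq0 _ _ _ _ lQ')// !mul0r.
(* The mass depends only on the total, so given the total all pairs of loop numbers are equally
   likely; [C] counts them. *)
pose C : \bar R :=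
  (\esum_(l in [set l : nat * nat | (l.1 + l.2 = k.1 + k.2)%N]) 1%:E)%E.
suff ratio P q : is_loop R P q -> sample_prob P (loop_sample k) /
    fine (Pr P [set y : sample 2 2 | count_stat y = count_stat (loop_sample k)]) =
    (fine C)^-1.
  by rewrite (ratio _ _ lQ) (ratio _ _ lQ').
move=> lP; rewrite (sample_prob_loop _ _ _ _ lP) -/(loop_mass R q k).
rewrite (Pr_loop _ _ _ _ lP).
have m0 := loop_mass_gt0 R q k (loop_q _ _ _ lP).
have -> : (\esum_(l in loop_sample @^-1`
      [set y : sample 2 2 | count_stat y = count_stat (loop_sample k)])
      (loop_mass R q l)%:E
    = (loop_mass R q k)%:E * C)%E.
  rewrite -esum_scale//.
  have -> : loop_sample @^-1` [set y : sample 2 2 | count_stat y = count_stat (loop_sample k)]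
      = [set l | (l.1 + l.2 = k.1 + k.2)%N].
    apply/seteqP; split=> l /=; rewrite !count_stat_loop; last by move=> ->.
    exact: loop_stat_inj.
  by apply: eq_esum => l /= lk; rewrite /loop_mass lk mule1.
rewrite fine_scale//.
by rewrite invfM mulrA divff ?gt_eqF// mul1r.
Qed.

Lemma half01 (R : realType) : 0 < (2^-1 : R) < 1. Proof. lra. Qed.
Lemma third01 (R : realType) : 0 < (3^-1 : R) < 1. Proof. lra. Qed.

(* Two possible samples with the same value of a sufficient statistic have a
   likelihood ratio independent of the parameter; comparing the parameters 1/2
   and 1/3 shows that they have the same number of loops. *)
Lemma sufficient_loop_count (R : realType) (p : R) (p01 : 0 < p < 1)
    (U : Type) (Y : sample 2 2 -> U) k l :
  sufficient (loop_chain R p p01) Y -> Y (loop_sample k) = Y (loop_sample l) ->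
  (k.1 + k.2 = l.1 + l.2)%N.
Proof.
move=> sY Ykl.
have H2 := is_loop_chain R _ (half01 R); have H3 := is_loop_chain R _ (third01 R).
have S2 := loop_same_support R _ _ p01 (half01 R).
have S3 := loop_same_support R _ _ p01 (third01 R).
pose t := Y (loop_sample k); pose A := [set y | Y y = t].
have Ak : A (loop_sample k) by [].
have Al : A (loop_sample l) by rewrite /A/= -Ykl.
have e := sY _ _ S2 S3 t (Pr_loop_gt0 _ _ _ _ _ H2 Ak) (Pr_loop_gt0 _ _ _ _ _ H3 Ak).
have := e _ Al; have := e _ Ak => {e}.
have := fine_Pr_loop_gt0 _ _ _ _ _ H2 Ak; have := fine_Pr_loop_gt0 _ _ _ _ _ H3 Ak.
rewrite -/A.
move: (fine _) => z3; move: (fine _) => z2 z3_gt0 z2_gt0.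
rewrite !(sample_prob_loop _ _ _ _ H2) !(sample_prob_loop _ _ _ _ H3).
set m := (k.1 + k.2)%N; set n := (l.1 + l.2)%N.
(* [c] collects the factors free of the loop number. Both totals satisfy [(3 / 2) ^+ j = c], and
   powers of a base above 1 determine the exponent. *)
pose c : R := (1 - 3^-1) ^+ 2 / z3 / ((1 - 2^-1) ^+ 2 / z2).
have ratio j : 2^-1 ^+ j * (1 - 2^-1) ^+ 2 / z2 =
    3^-1 ^+ j * (1 - 3^-1) ^+ 2 / z3 -> (3 / 2) ^+ j = c.
  move=> ej; rewrite /c -[_ / z3](mulKf (x := 3^-1 ^+ j)); last first.
    by rewrite expf_neq0// invr_neq0.
  rewrite (mulrA (3^-1 ^+ j)) -ej expr_div_n -!exprVn invrK.
  have z20 : z2 != 0 by rewrite gt_eqF.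
  rewrite exprVn; field.
  by rewrite z20 !expf_neq0 //; lra.
move=> /ratio em /ratio en.
by apply: (ieexprIn (x := 3 / 2 : R)); rewrite ?em ?en//; lra.
Qed.

(** [f] picks a possible sample in the fibre of [Y] and returns its counts; by
    [sufficient_loop_count] the pick does not matter. The default [(0, 0)] serves values that [Y]
    takes at no possible sample. *)
Lemma count_stat_loop_minimal (R : realType) (p : R) (p01 : 0 < p < 1) :
  minimal (loop_chain R p p01) (@count_stat 2 2).
Proof.
move=> U Y sY.
pose f u := loop_stat (let k := xget (0, 0)%N [set k | Y (loop_sample k) = u] in
  k.1 + k.2)%N.
exists f => Q /same_support_loop lQ; rewrite (Pr_loop _ _ _ _ lQ).
rewrite (_ : loop_sample @^-1` _ = set0) ?esum_set0//.
apply/seteqP; split=> // k /=; apply; rewrite count_stat_loop /f; congr loop_stat.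
apply: (sufficient_loop_count _ _ p01 _ _ _ _ sY); symmetry.
exact: (@xgetPex _ _ [set l | Y (loop_sample l) = Y (loop_sample k)]
  (ex_intro _ k erefl)).
Qed.

(* The coefficient of order [j] is compared with the tail of the other series
   at the parameter [t / 2], as [t] tends to [0]. *)
Lemma loop_series_coef0 (R : realType) (a b : nat -> R) (j : nat) :
  (forall i, 0 <= a i) -> (forall i, 0 <= b i) ->
  (forall q, 0 < q < 1 ->
    (\esum_(k in [set: nat * nat]) (loop_mass R q k * a (k.1 + k.2)%N)%:E =
     \esum_(k in [set: nat * nat]) (loop_mass R q k * b (k.1 + k.2)%N)%:E)%E) ->
  (\esum_(k in [set: nat * nat]) (loop_mass R 2^-1 k * b (k.1 + k.2)%N)%:E
     < +oo)%E ->
  (forall i, (i <= j)%N -> b i = 0) -> a j = 0.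
Proof.
move=> a0 b0 eab finB bj.
have massb0 (q : R) k : 0 < q < 1 -> 0 <= loop_mass R q k * b (k.1 + k.2)%N.
  by move=> q01; rewrite mulr_ge0// ltW// loop_mass_gt0.
set Bsum := (\esum_(k in _) _)%E in finB.
have Bsum_ge0 : (0 <= Bsum)%E.
  by apply: esum_ge0 => k _; rewrite lee_fin massb0// half01.
pose B := fine Bsum.
have BE : Bsum = B%:E by rewrite /B fineK// ge0_fin_numE.
have B_ge0 : 0 <= B by rewrite fine_ge0.
(* The term of the pair [(j, 0)] at parameter [t / 2] is at most the whole series of [b] there. The
   constant 16 is 4 times 4: one factor inverts [(1 - 2^-1) ^+ 2], the other comes from
   [(1 - t / 2) ^+ 2 >= 4^-1]. *)
have bound (t : R) : 0 < t -> t < 1 -> a j <= 2 ^+ j * 16 * B * t.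
  move=> t0 t1; have q01 : 0 < t / 2 < 1 by lra.
  have le1 : ((loop_mass R (t / 2) (j, 0%N) * a j)%:E <=
      (t ^+ j.+1 * 4)%:E * Bsum)%E.
    have := le_esum_term _ _ [set: nat * nat]
      (fun k => (loop_mass R (t / 2) k * a (k.1 + k.2)%N)%:E)%E (j, 0%N) I.
    rewrite eab//= addn0 => /le_trans; apply.
    rewrite -esum_scale; last 2 first.
    - by rewrite mulr_gt0// exprn_gt0.
    - by move=> k; rewrite lee_fin massb0// half01.
    apply: le_esum => k _; rewrite -EFinM lee_fin.
    (* Only totals above [j] contribute, and there [t ^+ m <= t ^+ j.+1] gains one power of [t] over
       the term of order [j]. *)
    have [/bj ->|jk] := leqP (k.1 + k.2)%N j; first by rewrite !mulr0.
    rewrite mulrA ler_wpM2r// /loop_mass expr_div_n.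
    set m := (k.1 + k.2)%N in jk *.
    have tm : t ^+ m <= t ^+ j.+1 by rewrite ler_wiXn2l // ltW.
    have h0 : 0 < (2^-1 : R) ^+ m by rewrite exprn_gt0.
    have -> : t ^+ m / 2 ^+ m * (1 - t / 2) ^+ 2
      = t ^+ m * (2^-1 ^+ m * (1 - t / 2) ^+ 2) by rewrite exprVn; ring.
    have -> : t ^+ j.+1 * 4 * (2^-1 ^+ m * (1 - 2^-1) ^+ 2)
      = t ^+ j.+1 * 2^-1 ^+ m by field.
    apply: ler_pM => //; first by rewrite exprn_ge0 ?ltW.
      by rewrite mulr_ge0 ?sqr_ge0 ?ltW.
    by rewrite ler_piMr ?ltW//; nra.
  move: le1; rewrite BE -EFinM lee_fin /loop_mass /= addn0 expr_div_n (exprS t j) => le1.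
  have tj : 0 < t ^+ j by rewrite exprn_gt0.
  have pj : 0 < (2 : R) ^+ j by rewrite exprn_gt0.
  have : (1 - t / 2) ^+ 2 * a j <= 2 ^+ j * 4 * B * t.
    have u0 := divr_gt0 tj pj; rewrite -(ler_pM2l u0) [leLHS]mulrA.
    apply: le_trans le1 _; rewrite le_eqVlt; apply/orP; left; apply/eqP; field.
    by rewrite gt_eqF.
  have : 4^-1 <= (1 - t / 2) ^+ 2 by nra.
  have := a0 j => aj s1 s2.
  have : 4^-1 * a j <= 2 ^+ j * 4 * B * t by apply: le_trans s2; rewrite ler_wpM2r.
  lra.
apply/eqP; rewrite eq_le a0 andbT leNgt; apply/negP => aj.
have pj : 0 < (2 : R) ^+ j by rewrite exprn_gt0.
pose C := 2 ^+ j * 16 * B.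
have C0 : 0 <= C by rewrite !mulr_ge0// ltW.
(* Chosen so that [0 < t < 1] and [C * t <= a j / 2], which contradicts [bound] for positive
   [a j]. *)
pose t := a j / (a j + C + 1) / 2.
have d0 : 0 < a j + C + 1 by lra.
have u0 : 0 < a j / (a j + C + 1) by rewrite divr_gt0.
have u1 : a j / (a j + C + 1) < 1 by rewrite ltr_pdivrMr //; lra.
have := bound t; rewrite -/C /t => /(_ _ _)/wrap[]; try lra.
rewrite leNgt => /negP; apply.
have : C * (a j / (a j + C + 1)) <= a j.
  by rewrite mulrA ler_pdivrMr//; nra.
nra.
Qed.

(** With [a] and [b] the positive and negative parts of [G], zero expectation makes their series
    agree at every parameter. At the least index where [G] is nonzero, one part is positive while
    the other vanishes up to that index, against [loop_series_coef0]. *)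
Lemma count_stat_loop_complete (R : realType) (p : R) (p01 : 0 < p < 1) :
  complete (loop_chain R p p01) (@count_stat 2 2).
Proof.
move=> g Hg Q /same_support_loop lQ; rewrite (Pr_loop _ _ _ _ lQ).
pose G m := g (loop_stat m).
suff G0 m : G m = 0.
  rewrite (_ : loop_sample @^-1` _ = set0) ?esum_set0//.
  by apply/seteqP; split=> // k /=; apply; rewrite count_stat_loop -/(G _) G0.
pose a i := Num.max (G i) 0; pose b i := Num.max (- G i) 0.
have a0 i : 0 <= a i by rewrite /a le_max lexx orbT.
have b0 i : 0 <= b i by rewrite /b le_max lexx orbT.
have Hq (q : R) : 0 < q < 1 ->
    (\esum_(k in [set: nat * nat]) (loop_mass R q k * a (k.1 + k.2)%N)%:E =
     \esum_(k in [set: nat * nat]) (loop_mass R q k * b (k.1 + k.2)%N)%:E)%E /\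
    (\esum_(k in [set: nat * nat]) (loop_mass R q k * b (k.1 + k.2)%N)%:E
     < +oo)%E.
  move=> q01; have [] := Hg _ (loop_same_support R _ _ p01 q01).
  have lq := is_loop_chain R _ q01.
  rewrite /integrable_rv /expect /expect_on.
  set f := (fun x : sample 2 2 => _) => sf.
  (* [h] will be the positive or the negative part; [h 0 = 0] discards the impossible samples. *)
  have reindex (h : \bar R -> \bar R) : h 0%E = 0%E ->
      (\esum_(x in [set: sample 2 2]) h (f x) =
       \esum_(k in [set: nat * nat]) h (loop_mass R q k * G (k.1 + k.2)%N)%:E)%E.
    move=> h0; rewrite (esum_inj_support _ _ _ loop_sample); first last.
    - by move=> x nx; rewrite /f (sample_prob_eq0 _ _ _ _ lq nx) mul0r.
    - exact: loop_sample_inj.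
    rewrite preimage_setT; apply: eq_esum => k _.
    by rewrite /f (sample_prob_loop _ _ _ _ lq) /= count_stat_loop.
  have Ea : (\esum_(x in [set: sample 2 2]) f^\+ x =
      \esum_(k in [set: nat * nat]) (loop_mass R q k * a (k.1 + k.2)%N)%:E)%E.
    have h0 : (maxe 0 0 = 0 :> \bar R)%E by rewrite maxxx.
    transitivity (\esum_(x in [set: sample 2 2]) maxe (f x) 0)%E.
      by apply: eq_esum => x _; rewrite funeposE.
    apply: (etrans (reindex (fun x => maxe x 0)%E h0)).
    apply: eq_esum => k _.
    by rewrite -EFin_max maxr_pMr ?mulr0// ltW// loop_mass_gt0.
  have Eb : (\esum_(x in [set: sample 2 2]) f^\- x =
      \esum_(k in [set: nat * nat]) (loop_mass R q k * b (k.1 + k.2)%N)%:E)%E.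
    have h0 : (maxe (- 0) 0 = 0 :> \bar R)%E by rewrite oppe0 maxxx.
    transitivity (\esum_(x in [set: sample 2 2]) maxe (- f x) 0)%E.
      by apply: eq_esum => x _; rewrite funenegE.
    apply: (etrans (reindex (fun x => maxe (- x) 0)%E h0)).
    apply: eq_esum => k _.
    by rewrite -EFinN -mulrN -EFin_max maxr_pMr ?mulr0// ltW// loop_mass_gt0.
  (* Summability makes both sums finite, so equality of their [fine] values is equality of the
     sums. *)
  have fa := summable_funepos sf; have fb := summable_funeneg sf.
  rewrite -Ea -Eb; move: fa fb; rewrite !summableE.
  have abs_id (u : sample 2 2 -> \bar R) : (forall x, 0 <= u x)%E ->
    (\esum_(x in [set: sample 2 2]) `|u x| = \esum_(x in [set: sample 2 2]) u x)%E.
    by move=> u0; apply: eq_esum => x _; rewrite gee0_abs.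
  rewrite !abs_id//.
  move=> fa fb /eqP; rewrite subr_eq0 => /eqP e; split.
    by rewrite -(fineK fa) -(fineK fb) e.
  by rewrite -(fineK fb) ltry.
apply/eqP/negPn/negP => Gm.
have [j Gj minj] := ex_minnP (ex_intro (fun m => G m != 0) m Gm).
have Gi i : (i < j)%N -> G i = 0.
  by move=> ij; apply/eqP; apply: contraLR ij => /minj; rewrite -leqNgt.
have [Gneg|Gpos|//] := ltgtP (G j) 0; last by move/eqP: Gj.
(* For a negative leading value the two series exchange roles. *)
- have : b j = 0.
    apply: (loop_series_coef0 R b a) => //.
    + by move=> q /Hq[].
    + by have [-> ] := Hq _ (half01 R).
    move=> i; rewrite leq_eqVlt /a => /orP[/eqP ->|/Gi ->]; last by rewrite maxxx.
    by apply/max_idPr; rewrite ltW.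
  by rewrite /b max_l; lra.
- have : a j = 0.
    apply: (loop_series_coef0 R a b) => //.
    + by move=> q /Hq[].
    + by have [_ ] := Hq _ (half01 R).
    move=> i; rewrite leq_eqVlt /b => /orP[/eqP ->|/Gi ->].
      by apply/max_idPr; lra.
    by rewrite oppr0 maxxx.
  by rewrite /a max_l; lra.
Qed.

(** * The reward process and its three estimators *)

Definition loop_mrp (R : realType) (gamma : R) (gamma_gt0 : 0 < gamma)
    (gamma_le1 : gamma <= 1) : mrp R 2 :=
  Mrp (loop_chain R 2^-1 (half01 R)) (fun _ j => (j == 1)%:R)
    gamma_gt0 gamma_le1.

(** Every possible path has 0 at index 0, so any other state occurs at a positive index. *)
Lemma loop_full_information (R : realType) (p : R) (p01 : 0 < p < 1) :
  full_information (loop_chain R p p01) 0.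
Proof.
move=> s' s'0 _ w wp i; have [[k _ <-]|nw] := pselect (range loop_path w).
  case: i => [[e]|i _]; first by rewrite e eqxx in s'0.
  by exists 0%N.
by move: wp; rewrite (path_prob_eq0 _ _ _ _ (is_loop_chain R p p01) nw) ltxx.
Qed.

Section LoopEstimators.
Context (R : realType) (gamma : R) (gamma_gt0 : 0 < gamma).
Context (gamma_le1 : gamma <= 1).
Let M := loop_mrp R gamma gamma_gt0 gamma_le1.

Lemma first_visit_return_loop k :
  first_visit_return M 0 (loop_path k) = gamma ^+ k.
Proof.
rewrite /first_visit_return /loop_path /= ?drop0 size_rcons size_nseq /=.
(* Only the last of the [k.+1] transitions is rewarded, with weight [gamma ^+ k]. *)
rewrite big_ord_recr /= nth_rcons size_nseq ltnn eqxx /= mulr1.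
rewrite big1 ?add0r// => i _.
by rewrite /= nth_rcons size_nseq ltn_ord nth_nseq ltn_ord mulr0.
Qed.

Lemma MC_loop k :
  MC M 0 (loop_sample k) = (gamma ^+ k.1 + gamma ^+ k.2) / 2.
Proof.
by rewrite /MC /= !big_cons big_nil /= ?inE ?eqxx /= !first_visit_return_loop addr0.
Qed.

Lemma loop_sample_total2 :
  loop_sample @^-1` [set y : sample 2 2 | count_stat y =
    count_stat (loop_sample (1, 1)%N)] =
  [set` [:: (0, 2); (1, 1); (2, 0)]%N].
Proof.
apply/seteqP; split=> [[k l] /=|k /=].
  rewrite !count_stat_loop => /loop_stat_inj /=.
  by case: k => [|[|[|k]]]; case: l => [|[|[|l]]] //= e; lia.
by rewrite !count_stat_loop !inE => /or3P[] /eqP ->.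
Qed.

(** At parameter 1/2 each of the three pairs has mass 1/16, so the conditional expectation is the
    plain average of the MC values [(1 + gamma ^+ 2) / 2], [gamma] and [(gamma ^+ 2 + 1) / 2]. *)
Lemma MVU_loop11 :
  MVU M 0 (loop_sample (1, 1)%N) = (1 + gamma + gamma ^+ 2) / 3.
Proof.
rewrite /MVU /cond_expect /expect_on.
have lM := is_loop_chain R _ (half01 R).
have sum3 (f : nat * nat -> \bar R) : (forall k, 0 <= f k)%E ->
    (\esum_(k in [set` [:: (0, 2); (1, 1); (2, 0)]%N]) f k =
     f (0, 2)%N + (f (1, 1)%N + f (2, 0)%N))%E.
  move=> f0; rewrite esum_fset//; last exact: finite_seq.
  by rewrite -fsbig_seq// !big_cons big_nil /= addr0.
have PrM A : Pr M A =
  \esum_(k in loop_sample @^-1` A) (loop_mass R 2^-1 k)%:E by exact: Pr_loop.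
rewrite PrM loop_sample_total2 sum3; last first.
  by move=> k; rewrite lee_fin ltW// loop_mass_gt0// half01.
pose f := (fun x : sample 2 2 => (sample_prob M x * MC M 0 x)%:E); rewrite -/f.
have fE k : f (loop_sample k) =
    (loop_mass R 2^-1 k * ((gamma ^+ k.1 + gamma ^+ k.2) / 2))%:E.
  by rewrite /f MC_loop (sample_prob_loop _ _ _ _ lM).
have f0 k : (0 <= f (loop_sample k))%E.
  rewrite fE lee_fin mulr_ge0//; first by rewrite ltW// loop_mass_gt0// half01.
  by rewrite divr_ge0// addr_ge0// exprn_ge0// ltW.
have fout x : ~ range loop_sample x -> f x = 0%E.
  by move=> nx; rewrite /f (sample_prob_eq0 _ _ _ _ lM nx) mul0r.
rewrite (esum_inj_support _ _ _ loop_sample _ f^\+%E); first last.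
- by move=> x /fout fx; rewrite funeposE fx maxxx.
- exact: loop_sample_inj.
rewrite (esum_inj_support _ _ _ loop_sample _ f^\-%E); first last.
- by move=> x /fout fx; rewrite funenegE fx oppe0 maxxx.
- exact: loop_sample_inj.
rewrite loop_sample_total2 !sum3//.
(* [f] is nonnegative on possible samples, so only its positive part contributes. *)
have fp k : f^\+%E (loop_sample k) = f (loop_sample k).
  by rewrite funeposE; apply/max_idPl.
have fn k : f^\-%E (loop_sample k) = 0%E.
  by rewrite funenegE; apply/max_idPr; rewrite leeNl oppe0.
rewrite !fp !fn !fE /loop_mass /= !addr0 !addn0 !add0n; by field.
Qed.

(** The linear system is solved by checking the candidate [v]; the explicit inverse [L] shows that
    [A] is a unit, so that [invmx] is a true inverse. *)
Lemma ML_loop11 : ML M 0 (loop_sample (1, 1)%N) = (2 - gamma)^-1.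
Proof.
set x := loop_sample _.
have v0 := num_visits_loop (1, 1)%N; rewrite -/x in v0.
(* Two loops and two exits among the four visits to 0 give 2/4 for both entries. *)
have T00 : trans_hat R x 0 0 = 2^-1.
  by rewrite mxE num_trans_loop v0 /=; field.
have T01 : trans_hat R x 0 1 = 2^-1.
  by rewrite mxE num_trans_loop v0 /=; field.
have T1 j : trans_hat R x 1 j = 0.
  by rewrite mxE num_trans_loop /= mul0r.
have g2 : 2 - gamma != 0.
  by rewrite gt_eqF// subr_gt0 (le_lt_trans gamma_le1)// ltr1n.
pose A : 'M[R]_2 := 1%:M - gamma *: trans_hat R x.
pose v : 'cV[R]_2 := \col_i (if i == 0 then (2 - gamma)^-1 else 0).
have AE i j : A i j = (i == j)%:R - gamma * trans_hat R x i j.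
  by rewrite [LHS]mxE [X in X + _]mxE [X in _ + X]mxE [X in - X]mxE.
have A00 : A 0 0 = 1 - gamma / 2 by rewrite AE T00.
have A01 : A 0 1 = - (gamma / 2) by rewrite AE T01 sub0r.
have A1 j : A 1 j = (j == 1)%:R by rewrite AE T1 mulr0 subr0 eq_sym.
have Au : A \in unitmx.
  pose L : 'M[R]_2 := \matrix_(i, j) (if i == 0 then
     if j == 0 then 2 / (2 - gamma) else gamma / (2 - gamma) else (j == 1)%:R).
  have : L *m A = 1%:M.
    apply/matrixP => i j; rewrite [LHS]mxE sum_ord2 [RHS]mxE.
    rewrite [L i 0]mxE [L i 1]mxE A1.
    by case: (ord2E i) => ->; case: (ord2E j) => -> /=; rewrite ?A00 ?A01; field.
  by case/mulmx1_unit.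
have Av : A *m v = reward_hat M x.
  apply/matrixP => i j.
  rewrite [LHS]mxE sum_ord2 [v 0 j]mxE [v 1 j]mxE [RHS]mxE sum_ord2.
  by case: (ord2E i) => ->; rewrite ?T00 ?T01 ?T1 ?A00 ?A01 ?A1 /=; field.
by rewrite /ML -/A -Av mulKmx// mxE.
Qed.

End LoopEstimators.

Theorem mainTheorem19 (R : realType) (gamma : R)
    (gamma_gt0 : 0 < gamma) (gamma_lt1 : gamma < 1) :
  exists (N : nat) (M : mrp R N) (s : 'I_N) (n : nat),
    [/\ discount M = gamma,
        full_information M s,
        minimal_complete_sufficient M (@count_stat N n) &
        (0 < Pr M [set x : sample N n |
                     MC M s x <> MVU M s x /\ MC M s x <> ML M s x])%E].
Proof.
exists 2, (loop_mrp R gamma gamma_gt0 (ltW gamma_lt1)), 0, 2; split.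
- by [].
- exact: loop_full_information.
- split.
  + exact: count_stat_loop_sufficient.
  + exact: count_stat_loop_complete.
  + exact: count_stat_loop_minimal.
- apply: (Pr_loop_gt0 _ _ _ _ (1, 1)%N (is_loop_chain R _ (half01 R))).
  rewrite /= MC_loop MVU_loop11 ML_loop11 /= expr1.
  (* Cleared of denominators, each supposed equality contradicts this strict inequality, which rests
     on [gamma < 1]. *)
  have g1 : 0 < (1 - gamma) ^+ 2 by rewrite exprn_gt0// subr_gt0.
  split; first by move=> e; nra.
  have g2 : 2 - gamma != 0 by rewrite gt_eqF//; lra.
  move=> /(congr1 (fun z => z * (2 - gamma))); rewrite mulVf//; nra.
Qed.
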